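(* The homomorphism $$\omega\colon\mathbb{Z}^4\to G_0(\mathbb{Q}\mathbb{A}),\quad(n_1,n_2,n_3,n_4)\mapsto n_1[I_1(\mathbb{Q})]+n_2[I_2(\mathbb{Q})]+n_3[\mathbb{Q}\,\mathrm{mor}(?,a_3)]+n_4[I_4(\mathbb{Q})]$$ and the composite $$G_0(\mathbb{Q}\mathbb{A})\xrightarrow{\mathrm{Res}}\bigoplus_{i=1}^4G_0(\mathbb{Q})\xrightarrow{\bigoplus_{i=1}^4\mathrm{rk}_{\mathbb{Q}}}\mathbb{Z}^4$$ are isomorphisms.
   Context: $\mathbb{A}$ is the category with four objects $a_1,a_2,a_3,a_4$ and morphism sets $\mathrm{mor}(a_1,a_1)=\{\mathrm{id},f_{11}\}$, $\mathrm{mor}(a_1,a_2)=\{f_{12},g_{12}\}$, $\mathrm{mor}(a_1,a_3)=\{f_{13}\}$, $\mathrm{mor}(a_1,a_4)=\{f_{14}\}$, $\mathrm{mor}(a_2,a_1)=\{f_{21},g_{21}\}$, $\mathrm{mor}(a_2,a_2)=\{\mathrm{id},f_{22}\}$, $\mathrm{mor}(a_2,a_3)=\{f_{23}\}$, $\mathrm{mor}(a_2,a_4)=\{f_{24},g_{24}\}$, $\mathrm{mor}(a_3,a_1)=\{f_{31}\}$, $\mathrm{mor}(a_3,a_2)=\{f_{32}\}$, $\mathrm{mor}(a_3,a_3)=\{\mathrm{id}=f_{33}\}$, $\mathrm{mor}(a_3,a_4)=\{f_{34}\}$, $\mathrm{mor}(a_4,a_4)=\{\mathrm{id}=f_{44}\}$,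 and $\mathrm{mor}(a_4,a_j)=\emptyset$ for $j\ne4$. Composition: for non-identity morphisms $p\colon a_i\to a_j$ and $q\colon a_j\to a_k$, $q\circ p=f_{ik}$. A $\mathbb{Q}\mathbb{A}$-module is a functor $\mathbb{A}^{op}\to\mathbb{Q}\text{-Mod}$ (exactness objectwise); it is finitely generated iff all its values are finite-dimensional. $G_0(\mathbb{Q}\mathbb{A})$ is the Grothendieck group of finitely generated $\mathbb{Q}\mathbb{A}$-modules modulo short exact sequences, and similarly $G_0(\mathbb{Q})$. $\mathrm{Res}[M]:=([M(a_1)],[M(a_2)],[M(a_3)],[M(a_4)])$, and $\mathrm{rk}_{\mathbb{Q}}$ is the $\mathbb{Q}$-dimension. $\mathbb{Q}\,\mathrm{mor}(?,a_3)$ sends $y$ to the $\mathbb{Q}$-vector space with basis $\mathrm{mor}(y,a_3)$. For $k\in\{1,2,4\}$, $I_k(\mathbb{Q})$ is the $\mathbb{Q}\mathbb{A}$-module with value $\mathbb{Q}$ at $a_k$, value $0$ at $a_j$ for $j\ne k$, and on which all morphisms except $\mathrm{id}_{a_k}$ act as zero. *)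

(* Defs.v *)
From HB Require Import structures.
From mathcomp Require Import all_boot all_order all_algebra.
From mathcomp Require Import boolp.

Set Implicit Arguments.
Unset Strict Implicit.
Unset Printing Implicit Defensive.

Import GRing.Theory.
Local Open Scope ring_scope.

(* A Grothendieck group of modules is generated by a type living in a universe
   above the one of [vectType], hence above the one of [choiceType]. It can
   therefore not be given the structure of a [zmodType], and a plain record is
   used for abelian groups instead. *)
Record abGroup := AbGroup {
  ab_sort :> Type;
  ab_zero : ab_sort;
  ab_opp : ab_sort -> ab_sort;
  ab_add : ab_sort -> ab_sort -> ab_sort;
  ab_addA : associative ab_add;
  ab_addC : commutative ab_add;
  ab_add0 : left_id ab_zero ab_add;
  ab_addN : left_inverse ab_zero ab_opp ab_add }.

Arguments ab_zero {a}.
Arguments ab_opp {a}.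
Arguments ab_add {a}.

Declare Scope ab_scope.
Delimit Scope ab_scope with AB.
Notation "x + y" := (ab_add x y) : ab_scope.

Definition ab_mulz (G : abGroup) (n : int) (x : G) : G :=
  match n with
  | Posz m => iter m (ab_add x) ab_zero
  | Negz m => ab_opp (iter m.+1 (ab_add x) ab_zero)
  end.

Notation "n * x" := (ab_mulz n x) : ab_scope.

Definition is_hom (G H : abGroup) (f : G -> H) : Prop :=
  {morph f : x y / (x + y)%AB}.

Definition is_iso (G H : abGroup) (f : G -> H) : Prop :=
  is_hom f /\ bijective f.

Definition zmod_ab (Z : zmodType) : abGroup :=
  @AbGroup Z 0 -%R +%R (@addrA Z) (@addrC Z) (@add0r Z) (@addNr Z).

Section Product.
Variables G H : abGroup.

Definition prod_add (x y : G * H) := ((x.1 + y.1)%AB, (x.2 + y.2)%AB).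

Lemma prod_addA : associative prod_add.
Proof. by move=> x y z; rewrite /prod_add !ab_addA. Qed.

Lemma prod_addC : commutative prod_add.
Proof. by move=> x y; congr pair; apply: ab_addC. Qed.

Lemma prod_add0 : left_id (ab_zero, ab_zero) prod_add.
Proof. by case=> x y; rewrite /prod_add !ab_add0. Qed.

Lemma prod_addN :
  left_inverse (ab_zero, ab_zero) (fun x => (ab_opp x.1, ab_opp x.2)) prod_add.
Proof. by case=> x y; rewrite /prod_add !ab_addN. Qed.

Definition prod_ab : abGroup :=
  AbGroup prod_addA prod_addC prod_add0 prod_addN.

End Product.

Definition pow4_ab (G : abGroup) : abGroup :=
  prod_ab (prod_ab (prod_ab G G) G) G.

Definition map4 (S T : Type) (f : S -> T) (x : S * S * S * S) :
    T * T * T * T :=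
  let: (x1, x2, x3, x4) := x in (f x1, f x2, f x3, f x4).

(* The abelian group presented by one generator for each M : T and one relation
   [B] = [A] + [C] for each [ses A B C], as the quotient of the group words by
   the smallest congruence; an element of the quotient is a congruence class,
   seen as a predicate. *)
Section Grothendieck.
Variables (T : Type) (ses : T -> T -> T -> Prop).

Inductive gword :=
| GCls of T
| GZero
| GOpp of gword
| GAdd of gword & gword.

Inductive geq : gword -> gword -> Prop :=
| geq_refl u : geq u u
| geq_sym u v : geq u v -> geq v u
| geq_trans u v w : geq u v -> geq v w -> geq u w
| geq_opp u u' : geq u u' -> geq (GOpp u) (GOpp u')
| geq_add u u' v v' : geq u u' -> geq v v' -> geq (GAdd u v) (GAdd u' v')
| geq_addA u v w : geq (GAdd u (GAdd v w)) (GAdd (GAdd u v) w)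
| geq_addC u v : geq (GAdd u v) (GAdd v u)
| geq_add0 u : geq (GAdd GZero u) u
| geq_addN u : geq (GAdd (GOpp u) u) GZero
| geq_ses A B C : ses A B C -> geq (GCls B) (GAdd (GCls A) (GCls C)).

Definition gquot := {P : gword -> Prop | exists u, P = geq u}.

Lemma gquot_eq (x y : gquot) : sval x = sval y -> x = y.
Proof.
case: x y => [P HP] [Q HQ] /= E; case: Q / E HQ => HQ.
by rewrite (Prop_irrelevance HP HQ).
Qed.

Definition gpi (u : gword) : gquot :=
  exist _ (geq u) (ex_intro (fun v => geq u = geq v) u erefl).

Definition grepr (x : gquot) : gword := sval (cid (proj2_sig x)).

Lemma gpiP u v : gpi u = gpi v <-> geq u v.
Proof.
split=> [/(congr1 sval) /= E | E]; first by rewrite E; apply: geq_refl.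
apply: gquot_eq => /=; apply/funext => w; apply/propext.
by split=> H; [apply: geq_trans (geq_sym E) H | apply: geq_trans E H].
Qed.

Lemma greprK x : gpi (grepr x) = x.
Proof.
by apply: gquot_eq; rewrite /grepr; case: (cid _) => u /= ->.
Qed.

Lemma grepr_pi u : geq (grepr (gpi u)) u.
Proof. by apply/gpiP; rewrite greprK. Qed.

Definition gadd x y := gpi (GAdd (grepr x) (grepr y)).
Definition gopp x := gpi (GOpp (grepr x)).

Lemma gpi_add u v : gadd (gpi u) (gpi v) = gpi (GAdd u v).
Proof. by apply/gpiP/geq_add; apply: grepr_pi. Qed.

Lemma gpi_opp u : gopp (gpi u) = gpi (GOpp u).
Proof. by apply/gpiP/geq_opp; apply: grepr_pi. Qed.

Lemma gaddA : associative gadd.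
Proof.
move=> x y z; rewrite -[x]greprK -[y]greprK -[z]greprK !gpi_add.
by apply/gpiP; apply: geq_addA.
Qed.

Lemma gaddC : commutative gadd.
Proof. by move=> x y; apply/gpiP; apply: geq_addC. Qed.

Lemma gadd0 : left_id (gpi GZero) gadd.
Proof.
by move=> x; rewrite -[x]greprK gpi_add; apply/gpiP; apply: geq_add0.
Qed.

Lemma gaddN : left_inverse (gpi GZero) gopp gadd.
Proof.
move=> x; rewrite -[x]greprK gpi_opp gpi_add.
by apply/gpiP; apply: geq_addN.
Qed.

Definition groth : abGroup := AbGroup gaddA gaddC gadd0 gaddN.

Definition gcls (M : T) : groth := gpi (GCls M).

Lemma gcls_ses A B C : ses A B C -> gcls B = (gcls A + gcls C)%AB.
Proof. by move=> E; rewrite /= gpi_add; apply/gpiP/geq_ses. Qed.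

Section Lift.
Variables (G : abGroup) (f : T -> G).

Definition ses_additive : Prop :=
  forall A B C, ses A B C -> f B = (f A + f C)%AB.

Fixpoint geval (u : gword) : G :=
  match u with
  | GCls M => f M
  | GZero => ab_zero
  | GOpp v => ab_opp (geval v)
  | GAdd v w => (geval v + geval w)%AB
  end.

Definition groth_lift (fP : ses_additive) (x : groth) : G := geval (grepr x).

Hypothesis fP : ses_additive.

Lemma geval_geq u v : geq u v -> geval u = geval v.
Proof.
elim=> {u v} //=.
- by move=> u v w _ -> _ ->.
- by move=> u u' _ ->.
- by move=> u u' v v' _ -> _ ->.
- by move=> *; apply: ab_addA.
- by move=> *; apply: ab_addC.
- by move=> *; apply: ab_add0.
- by move=> *; apply: ab_addN.
Qed.

Lemma groth_lift_cls M : groth_lift fP (gcls M) = f M.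
Proof. exact: geval_geq (grepr_pi (GCls M)). Qed.

Lemma groth_lift_hom : is_hom (groth_lift fP).
Proof. by move=> x y; rewrite /groth_lift (geval_geq (grepr_pi _)). Qed.

End Lift.

Lemma groth_hom_unique (G : abGroup) (f g : groth -> G) :
  is_hom f -> is_hom g -> (forall M, f (gcls M) = g (gcls M)) -> f =1 g.
Proof.
move=> fD gD fg x; rewrite -[x]greprK.
have addI (a b c : G) : (a + c = b + c)%AB -> a = b.
  move=> /(congr1 (fun t => ab_opp c + t)%AB).
  rewrite (ab_addC a) (ab_addC b) !ab_addA !ab_addN.
  by rewrite !ab_add0.
have f0 (h : groth -> G) : is_hom h -> h (gpi GZero) = ab_zero.
  move=> hD; apply: (@addI _ _ (h (gpi GZero))).
  by rewrite -hD ab_add0 (ab_add0 (_ : groth)).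
elim: (grepr x) => [M||u IH|u IHu v IHv].
- exact: fg.
- by rewrite !f0.
- apply: (@addI _ _ (f (gpi u))).
  rewrite -fD IH -gD /= -gpi_opp.
  by rewrite (gaddN (gpi u)) !f0.
- by rewrite -gpi_add fD gD IHu IHv.
Qed.

End Grothendieck.

Record category := Category {
  ob :> Type;
  hom : ob -> ob -> Type;
  idm : forall x, hom x x;
  comp : forall x y z, hom y z -> hom x y -> hom x z;
  comp_id_l : forall x y (p : hom x y), comp (idm y) p = p;
  comp_id_r : forall x y (p : hom x y), comp p (idm x) = p;
  comp_assoc : forall x y z t (r : hom z t) (q : hom y z) (p : hom x y),
    comp r (comp q p) = comp (comp r q) p }.

(* Functors C^op -> F-Mod with finite-dimensional values; when C is finite these
   are exactly the finitely generated FC-modules. *)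
Record fmodule (F : fieldType) (C : category) := FModule {
  fm_val :> C -> vectType F;
  fm_act : forall x y, hom x y -> 'Hom(fm_val y, fm_val x);
  fm_id : forall x, fm_act (idm x) = \1%VF;
  fm_comp : forall x y z (q : hom y z) (p : hom x y),
    fm_act (comp q p) = (fm_act p \o fm_act q)%VF }.

Arguments fm_act {F C} f {x y}.

Definition short_exact (F : fieldType) (U V W : vectType F)
    (i : 'Hom(U, V)) (p : 'Hom(V, W)) : Prop :=
  [/\ lker i = 0%VS, limg i = lker p & limg p = fullv].

Definition vect_ses (F : fieldType) (U V W : vectType F) : Prop :=
  exists (i : 'Hom(U, V)) (p : 'Hom(V, W)), short_exact i p.

Definition natural (F : fieldType) (C : category) (M N : fmodule F C)
    (h : forall x, 'Hom(M x, N x)) : Prop :=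
  forall x y (p : hom x y), (h x \o fm_act M p = fm_act N p \o h y)%VF.

Definition module_ses (F : fieldType) (C : category) (L M N : fmodule F C) :
    Prop :=
  exists (i : forall x, 'Hom(L x, M x)) (p : forall x, 'Hom(M x, N x)),
    [/\ natural i, natural p & forall x, short_exact (i x) (p x)].

Definition G0_field (F : fieldType) : abGroup := groth (@vect_ses F).

Definition G0 (F : fieldType) (C : category) : abGroup :=
  groth (@module_ses F C).

Definition vcls (F : fieldType) (V : vectType F) : G0_field F :=
  gcls (@vect_ses F) V.

Definition mcls (F : fieldType) (C : category) (M : fmodule F C) : G0 F C :=
  gcls (@module_ses F C) M.

Notation ZZ := (zmod_ab int).

Section RankRes.
Variable F : fieldType.

Lemma dim_additive :
  ses_additive (@vect_ses F) (fun V => (\dim {: V})%:Z : ZZ).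
Proof.
move=> U V W [i [p [ki ip sp]]] /=.
rewrite -(limg_ker_dim p fullv) capfv -ip sp PoszD; congr (Posz _ + _).
by rewrite limg_dim_eq // ki capv0.
Qed.

Definition rk : G0_field F -> ZZ := groth_lift dim_additive.

Variables (C : category) (x : C).

Lemma val_additive :
  ses_additive (@module_ses F C) (fun M => vcls (M x)).
Proof.
by move=> L M N [i [p [_ _ e]]]; apply: gcls_ses; exists (i x), (p x).
Qed.

Definition Res_at : G0 F C -> G0_field F := groth_lift val_additive.

End RankRes.

Inductive A_ob := a1 | a2 | a3 | a4.

Definition A_ob_eqb (x y : A_ob) : bool :=
  match x, y with
  | a1, a1 | a2, a2 | a3, a3 | a4, a4 => true
  | _, _ => false
  end.

Lemma A_ob_eqP : Equality.axiom A_ob_eqb.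
Proof. by case; case; constructor. Qed.

HB.instance Definition _ := hasDecEq.Build A_ob A_ob_eqP.

(* The morphism f_{ij} (resp. g_{ij}) is the label [Lf] (resp. [Lg]) in the
   morphism set from a_i to a_j; the label [Lid] is the identity of a_1 or a_2,
   whereas the identity of a_3 or a_4 is f_{33} or f_{44}, i.e. [Lf]. *)
Inductive A_label := Lid | Lf | Lg.

Definition label_code (l : A_label) : option bool :=
  match l with Lid => None | Lf => Some false | Lg => Some true end.

Definition label_decode (c : option bool) : A_label :=
  match c with None => Lid | Some false => Lf | Some true => Lg end.

Lemma label_codeK : cancel label_code label_decode.
Proof. by case. Qed.

HB.instance Definition _ := Countable.copy A_label (can_type label_codeK).
HB.instance Definition _ : isFinite A_label := CanIsFinite label_codeK.

Definition A_labels (x y : A_ob) : seq A_label :=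
  match x, y with
  | a1, a1 | a2, a2 => [:: Lid; Lf]
  | a1, a2 | a2, a1 | a2, a4 => [:: Lf; Lg]
  | a4, (a1 | a2 | a3) => [::]
  | _, _ => [:: Lf]
  end.

Notation A_mor x y := {l : A_label | l \in A_labels x y}.

Definition id_label (x : A_ob) : A_label :=
  match x with a1 | a2 => Lid | a3 | a4 => Lf end.

Definition is_id (x y : A_ob) (l : A_label) : bool :=
  (x == y) && (l == id_label x).

Definition comp_label (x y z : A_ob) (q p : A_label) : A_label :=
  if is_id x y p then q else if is_id y z q then p else Lf.

Lemma id_labelP x : id_label x \in A_labels x x.
Proof. by case: x. Qed.

Lemma comp_labelP x y z q p :
  q \in A_labels y z -> p \in A_labels x y ->
  comp_label x y z q p \in A_labels x z.
Proof. by case: x; case: y; case: z; case: q; case: p. Qed.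

Definition A_id (x : A_ob) : A_mor x x := exist _ (id_label x) (id_labelP x).

Definition A_comp (x y z : A_ob) (q : A_mor y z) (p : A_mor x y) : A_mor x z :=
  exist _ (comp_label x y z (val q) (val p))
    (comp_labelP (valP q) (valP p)).

Lemma A_comp_id_l x y (p : A_mor x y) : A_comp (A_id y) p = p.
Proof. by apply: val_inj; case: p; case: x; case: y; case. Qed.

Lemma A_comp_id_r x y (p : A_mor x y) : A_comp p (A_id x) = p.
Proof. by apply: val_inj; case: p; case: x; case: y; case. Qed.

Lemma A_comp_assoc x y z t (r : A_mor z t) (q : A_mor y z) (p : A_mor x y) :
  A_comp r (A_comp q p) = A_comp (A_comp r q) p.
Proof.
apply: val_inj; case: r => r + ; case: q => q +; case: p => p +.
by case: x; case: y; case: z; case: t; case: r; case: q; case: p.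
Qed.

Definition AA : category := Category A_comp_id_l A_comp_id_r A_comp_assoc.

(* The vector space with basis mor(y, c) is {ffun mor(y, c) -> Q}; the morphism
   p : x -> y maps the basis vector q to the basis vector q o p. *)
Section FreeModule.
Variable c : A_ob.

Definition Qmor_val (y : A_ob) : vectType rat := {ffun A_mor y c -> rat^o}.

Definition Qmor_fun (x y : A_ob) (p : A_mor x y) (u : Qmor_val y) :
    Qmor_val x :=
  [ffun r => \sum_(q | A_comp q p == r) u q].

Fact Qmor_fun_linear x y p : linear (@Qmor_fun x y p).
Proof.
move=> a u v; apply/ffunP => r; rewrite !ffunE scaler_sumr -big_split /=.
by apply: eq_bigr => q _; rewrite !ffunE.
Qed.

HB.instance Definition _ x y p :=
  GRing.isLinear.Build rat _ _ _ (@Qmor_fun x y p) (@Qmor_fun_linear x y p).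

Definition Qmor_act (x y : AA) (p : hom x y) :
  'Hom(Qmor_val y, Qmor_val x) := linfun (Qmor_fun p).

Lemma Qmor_id x : Qmor_act (idm x) = \1%VF.
Proof.
apply/lfunP => u; rewrite !lfunE /=; apply/ffunP => r; rewrite ffunE.
by rewrite (big_pred1 r) // => q /=; rewrite A_comp_id_r.
Qed.

Lemma Qmor_comp (x y z : AA) (q : hom y z) (p : hom x y) :
  Qmor_act (comp q p) = (Qmor_act p \o Qmor_act q)%VF.
Proof.
apply/lfunP => u; rewrite comp_lfunE !lfunE /=; apply/ffunP => r.
rewrite !ffunE (partition_big (fun s => A_comp s q)
  (fun s => A_comp s p == r)) /=; last by move=> s; rewrite A_comp_assoc.
apply: eq_bigr => s /eqP sr; rewrite ffunE; apply: eq_bigl => t.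
case: (A_comp t q =P s) => [ts|_]; last by rewrite andbF.
by rewrite andbT A_comp_assoc ts sr eqxx.
Qed.

Definition Qmor : fmodule rat AA := FModule Qmor_id Qmor_comp.

End FreeModule.

(* There is no such module at a_3, since id_{a_3} = f_{13} o f_{31}. *)
Section Simple.
Variable k : A_ob.

Definition I_space (b : bool) : vectType rat :=
  if b then rat^o : vectType rat else 'rV[rat]_0 : vectType rat.

Definition I_map (b b' c : bool) : 'Hom(I_space b, I_space b') :=
  match b, b' with
  | true, true => if c then \1%VF else 0
  | _, _ => 0
  end.

Definition I_act (x y : AA) (p : hom x y) :
    'Hom(I_space (y == k), I_space (x == k)) :=
  I_map (y == k) (x == k) (is_id x y (val p)).

Hypothesis k_neq3 : k != a3.

Lemma I_id x : I_act (idm x) = \1%VF.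
Proof.
have -> : I_act (idm x) = I_map (x == k) (x == k) true.
  by rewrite /I_act /is_id /= !eqxx.
case: (x == k) => //=.
by apply/lfunP => v; rewrite !lfunE; apply/matrixP => i [].
Qed.

Lemma I_comp (x y z : AA) (q : hom y z) (p : hom x y) :
  I_act (comp q p) = (I_act p \o I_act q)%VF.
Proof.
move: k_neq3; rewrite /I_act; case: q => q +; case: p => p +.
case: k => // + + _; case: x; case: y; case: z; case: q; case: p => //= _ _;
  by rewrite ?comp_lfun0l ?comp_lfun0r ?comp_lfun1l.
Qed.

Definition I_ : fmodule rat AA := FModule I_id I_comp.

End Simple.

Definition omega (n : pow4_ab ZZ) : G0 rat AA :=
  let: (n1, n2, n3, n4) := n in
  (n1 * mcls (I_ (k := a1) isT) + n2 * mcls (I_ (k := a2) isT)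
   + n3 * mcls (Qmor a3) + n4 * mcls (I_ (k := a4) isT))%AB.

Definition Res (x : G0 rat AA) : pow4_ab (G0_field rat) :=
  (Res_at (a1 : AA) x, Res_at (a2 : AA) x,
   Res_at (a3 : AA) x, Res_at (a4 : AA) x).

Definition rk4 : pow4_ab (G0_field rat) -> pow4_ab ZZ := map4 (@rk rat).

(* Main.v *)
Require Import Defs.
From mathcomp Require Import all_boot all_order all_algebra.
From HB Require Import structures.
From mathcomp Require Import boolp.
From mathcomp Require Import ring zify.

Set Implicit Arguments.
Unset Strict Implicit.
Unset Printing Implicit Defensive.

(* The categorical [hom] and [comp] take precedence over their namesakes for
   vector spaces and functions. *)
Import Defs.
Import GRing.Theory.
Local Open Scope ring_scope.

(** On the four given classes the composite rk o Res is the matrix of dimension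
    vectors (1,0,0,0), (0,1,0,0), (1,1,1,0), (0,0,0,1), which is unimodular
    ([dim_vector_omega], with inverse [dim_coords]).  So omega is split
    injective and rk o Res is surjective; both are isomorphisms as soon as the
    four classes generate G_0, that is, as soon as the endomorphism
    omega o dim_coords o rk o Res of G_0 is the identity.  It fixes the four
    classes, and two homomorphisms out of G_0 that agree on them are equal
    ([G0_hom_ext]): this is a devissage ([devissage]) by induction on the total
    dimension, where it suffices to embed one of the four modules into any
    nonzero module M and to pass to the cokernel.

    The embedding comes from the shape of the category.  The identity of a_3
    factors through every object x admitting a morphism x -> a_3, and such a
    morphism is unique.  Hence any nonzero v in M(a_3) generates, through the
    Yoneda map, a copy of Q mor(?, a_3) ([yoneda_a3_inj]).  If M(a_3) = 0, then,
    since the composite of two non-identity morphisms factors through a_3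
    ([comp_nonid_factors]), every such composite acts by zero on M.  So either
    some non-identity morphism has a nonzero vector in its image, or all of
    them act by zero; in both cases there is a nonzero vector killed by all
    non-identity morphisms ([exists_socle_vector]), and it spans a copy of some
    I_k, where k is not 3 because M(a_3) = 0. *)

(** * Abelian groups *)

Section AbGroupTheory.
Variable G : abGroup.
Implicit Types x y z : G.

Lemma ab_addr0 x : (x + ab_zero)%AB = x.
Proof. by rewrite ab_addC ab_add0. Qed.

Lemma ab_addrN x : (x + ab_opp x)%AB = ab_zero.
Proof. by rewrite ab_addC ab_addN. Qed.

Lemma ab_addI x y z : (x + y = x + z)%AB -> y = z.
Proof.
by move=> /(congr1 (ab_add (ab_opp x))); rewrite !ab_addA !ab_addN !ab_add0.
Qed.

Lemma ab_addACA x y z t : ((x + y) + (z + t) = (x + z) + (y + t))%AB.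
Proof.
by rewrite -!ab_addA; congr (_ + _)%AB; rewrite !ab_addA (ab_addC y).
Qed.

Lemma ab_add4 x1 x2 x3 x4 y1 y2 y3 y4 :
  ((x1 + y1) + (x2 + y2) + (x3 + y3) + (x4 + y4) =
   (x1 + x2 + x3 + x4) + (y1 + y2 + y3 + y4))%AB.
Proof.
by rewrite (ab_addACA x1) (ab_addACA (x1 + x2)%AB) (ab_addACA (_ + x3)%AB).
Qed.

Lemma ab_mulzS (n : int) x : ((n + 1)%R * x = x + n * x)%AB.
Proof.
case: n => [n|[|n]]; first by rewrite -PoszD addn1.
  by rewrite /= ab_addr0 ab_addrN.
have -> : Negz n.+1 + 1 = Negz n by lia.
rewrite /ab_mulz; set a := iter n.+1 _ _.
rewrite (_ : iter n.+2 _ _ = x + a)%AB //; apply: (@ab_addI a).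
by rewrite ab_addrN ab_addA (ab_addC a) ab_addrN.
Qed.

Lemma ab_mulzD (m n : int) x : ((m + n)%R * x = m * x + n * x)%AB.
Proof.
elim/int_rect: m => [|m IH|m IH]; first by rewrite add0r /= ab_add0.
  by rewrite -addn1 PoszD -addrAC !ab_mulzS IH ab_addA.
apply: (@ab_addI x); rewrite ab_addA -!ab_mulzS.
rewrite -addn1 PoszD opprD addrNK -IH.
by congr (_ * _)%AB; ring.
Qed.

Lemma ab_mul0z x : (0 * x)%AB = ab_zero.
Proof. by []. Qed.

Lemma ab_mul1z x : (1 * x)%AB = x.
Proof. exact: ab_addr0. Qed.

End AbGroupTheory.

Section HomTheory.
Variables (G H K : abGroup).

Lemma hom_zero (f : G -> H) : is_hom f -> f ab_zero = ab_zero.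
Proof.
by move=> fD; apply: (@ab_addI _ (f ab_zero)); rewrite -fD ab_addr0 ab_addr0.
Qed.

Lemma hom_opp (f : G -> H) : is_hom f -> {morph f : x / ab_opp x}.
Proof.
move=> fD x; apply: (@ab_addI _ (f x)).
by rewrite -fD !ab_addrN hom_zero.
Qed.

Lemma hom_mulz (f : G -> H) (n : int) : is_hom f -> {morph f : x / (n * x)%AB}.
Proof.
move=> fD x.
have iterE m : f (iter m (ab_add x) ab_zero) = iter m (ab_add (f x)) ab_zero.
  by elim: m => [|m IH] /=; rewrite ?hom_zero // fD IH.
by case: n => n; rewrite /ab_mulz ?hom_opp // iterE.
Qed.

Lemma hom_comp (g : H -> K) (f : G -> H) :
  is_hom g -> is_hom f -> is_hom (fun x => g (f x)).
Proof. by move=> gD fD x y /=; rewrite fD gD. Qed.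

End HomTheory.

Lemma int_mulz (n : int) (x : ZZ) : (n * x)%AB = n * x :> int.
Proof.
have iterE m : iter m (ab_add x) ab_zero = m%:Z * x :> int.
  elim: m => [|m IH] /=; first by rewrite mul0r.
  by rewrite [in LHS]IH -addn1 PoszD mulrDl mul1r addrC.
by case: n => n; rewrite /ab_mulz iterE // NegzE mulNr.
Qed.

Lemma pow4_add (G : abGroup) (x1 x2 x3 x4 y1 y2 y3 y4 : G) :
  (((x1, x2, x3, x4) : pow4_ab G) + (y1, y2, y3, y4))%AB =
  (x1 + y1, x2 + y2, x3 + y3, x4 + y4)%AB.
Proof. by []. Qed.

Lemma pow4_mulz (G : abGroup) (n : int) (x1 x2 x3 x4 : G) :
  (n * ((x1, x2, x3, x4) : pow4_ab G))%AB = (n * x1, n * x2, n * x3, n * x4)%AB.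
Proof.
have iterE m : iter m (ab_add ((x1, x2, x3, x4) : pow4_ab G)) ab_zero =
    (iter m (ab_add x1) ab_zero, iter m (ab_add x2) ab_zero,
     iter m (ab_add x3) ab_zero, iter m (ab_add x4) ab_zero).
  by elim: m => //= m ->.
by case: n => n; rewrite /ab_mulz iterE.
Qed.

(** * Cokernels of monomorphisms *)

Section Cokernel.
Variables (F : fieldType) (C : category) (M : fmodule F C).
Variable U : forall x, {vspace M x}.
Hypothesis U_stable : forall x y (p : hom x y) v,
  v \in U y -> fm_act M p v \in U x.

(** The quotient of [M x] by [U x] is realised as a complement of [U x], namely
    the image of an idempotent with kernel [U x]: this makes it a [vectType]. *)
Definition coker_proj x : 'End(M x) := (\1 - projv (U x))%VF.

Definition coker_val x : vectType F := subvs_of (limg (coker_proj x)).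

Definition coker_pi x : 'Hom(M x, coker_val x) :=
  (linfun (vsproj (limg (coker_proj x))) \o coker_proj x)%VF.

Definition coker_act x y (p : hom x y) : 'Hom(coker_val y, coker_val x) :=
  (coker_pi x \o fm_act M p \o linfun vsval)%VF.

Lemma coker_projE x v : coker_proj x v = v - projv (U x) v.
Proof. by rewrite !lfunE /= opp_lfunE id_lfunE. Qed.

Lemma val_coker_pi x v : vsval (coker_pi x v) = v - projv (U x) v.
Proof.
rewrite comp_lfunE lfunE /= vsprojK ?coker_projE //.
by rewrite -coker_projE memv_img ?memvf.
Qed.

Lemma lker_coker_pi x : lker (coker_pi x) = U x.
Proof.
apply/vspaceP => v; rewrite memv_ker; apply/eqP/idP => [pi0|/projv_id Uv].
  have := val_coker_pi v; rewrite pi0 linear0 => /esym/eqP.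
  by rewrite subr_eq0 => /eqP ->; apply: memv_proj.
by apply: (can_inj vsvalK); rewrite val_coker_pi Uv subrr [RHS]linear0.
Qed.

Lemma coker_pi_val x w : coker_pi x (vsval w) = w.
Proof.
apply: (can_inj vsvalK); rewrite val_coker_pi.
have /memv_imgP[v _ ->] := subvsP w.
by rewrite coker_projE linearB /= projv_proj subrr subr0.
Qed.

Lemma limg_coker_pi x : limg (coker_pi x) = fullv.
Proof.
by apply/vspaceP => w; rewrite memvf -(coker_pi_val w) memv_img ?memvf.
Qed.

Lemma coker_actE x y (p : hom x y) w :
  coker_act p w = coker_pi x (fm_act M p (vsval w)).
Proof. by rewrite !comp_lfunE (lfunE vsval). Qed.

(** The action on a representative is well defined modulo [U x] because [U] is
    stable; this is the naturality of the projection, and functoriality of the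
    cokernel follows from it by surjectivity. *)
Lemma coker_act_pi x y (p : hom x y) v :
  coker_act p (coker_pi y v) = coker_pi x (fm_act M p v).
Proof.
rewrite coker_actE val_coker_pi !linearB /=.
have : fm_act M p (projv (U y) v) \in lker (coker_pi x).
  by rewrite lker_coker_pi U_stable ?memv_proj.
by rewrite memv_ker => /eqP ->; rewrite subr0.
Qed.

Lemma coker_id x : coker_act (idm x) = \1%VF.
Proof.
by apply/lfunP => w; rewrite -(coker_pi_val w) coker_act_pi fm_id !id_lfunE.
Qed.

Lemma coker_comp x y z (q : hom y z) (p : hom x y) :
  coker_act (comp q p) = (coker_act p \o coker_act q)%VF.
Proof.
apply/lfunP => w; rewrite -(coker_pi_val w) comp_lfunE !coker_act_pi.
by rewrite fm_comp comp_lfunE.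
Qed.

Definition coker : fmodule F C := FModule coker_id coker_comp.

End Cokernel.

Lemma module_ses_coker (F : fieldType) (C : category) (L M : fmodule F C)
    (i : forall x, 'Hom(L x, M x)) :
  natural i -> (forall x, lker (i x) = 0%VS) -> exists N, module_ses L M N.
Proof.
move=> i_nat i_inj.
have stable x y (p : hom x y) v :
    v \in limg (i y) -> fm_act M p v \in limg (i x).
  case/memv_imgP=> u _ ->.
  by rewrite -comp_lfunE -i_nat comp_lfunE memv_img ?memvf.
exists (coker stable), i, (fun x => coker_pi (fun x => limg (i x)) x).
split=> // [x y p|x].
  apply/lfunP => v; rewrite [LHS]comp_lfunE [RHS]comp_lfunE; apply/esym.
  exact: coker_act_pi.
by split; rewrite ?lker_coker_pi ?limg_coker_pi.
Qed.

(** * Maps out of the four modules *)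

Section Yoneda.
Variables (M : fmodule rat AA) (c : A_ob) (v : M c).

Definition yoneda_fun (x : AA) (u : Qmor_val c x) : M x :=
  \sum_q u q *: fm_act M (q : hom x (c : AA)) v.

Fact yoneda_linear x : linear (@yoneda_fun x).
Proof.
move=> a u w; rewrite /yoneda_fun scaler_sumr -big_split /=.
by apply: eq_bigr => q _; rewrite !ffunE scalerDl scalerA.
Qed.

HB.instance Definition _ x :=
  GRing.isLinear.Build rat _ _ _ (@yoneda_fun x) (@yoneda_linear x).

Definition yoneda (x : AA) : 'Hom(Qmor c x, M x) := linfun (@yoneda_fun x).

(** Both sides send the basis vector [q] to the action of [q o p] on [v]. *)
Lemma yoneda_natural : natural yoneda.
Proof.
move=> x y p; apply/lfunP => u; rewrite !comp_lfunE /= !lfunE /=.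
rewrite /yoneda_fun linear_sum /=.
rewrite [RHS](partition_big (fun q => A_comp q p) xpredT) //=.
apply: eq_bigr => r _; rewrite ffunE scaler_suml; apply: eq_bigr => q /eqP <-.
by rewrite linearZ /= -comp_lfunE -fm_comp.
Qed.

End Yoneda.

Section LineMap.
Variables (V : vectType rat) (v : V).

Definition scale_by (c : rat^o) : V := c *: v.

Fact scale_by_linear : linear scale_by.
Proof. by move=> a b c; rewrite /scale_by scalerDl scalerA. Qed.

HB.instance Definition _ :=
  GRing.isLinear.Build rat rat^o _ _ scale_by scale_by_linear.

(** A map from an arbitrary value [I_space b] of a simple module, with the case
    distinction on [b] inside, so that naturality can be checked without
    rewriting [x == k] in dependent types. *)
Definition line_map (b : bool) : 'Hom(I_space b, V) :=
  match b with true => linfun scale_by | false => 0 end.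

Lemma I_space_false (u : I_space false) : u = 0.
Proof. by apply/matrixP => i []. Qed.

Lemma lker_line_map (b : bool) : (b -> v != 0) -> lker (line_map b) = 0%VS.
Proof.
move=> v0; apply/eqP; rewrite -subv0; apply/subvP => u; rewrite memv_ker memv0.
case: b v0 u => [/(_ isT) v0|_] u; last by rewrite (I_space_false u) eqxx.
by rewrite lfunE /= /scale_by scaler_eq0 (negPf v0) orbF.
Qed.

End LineMap.

Lemma line_map_natural (V W : vectType rat) (v : V) (w : W) (f : 'Hom(V, W))
    (b b' c : bool) :
  (b -> f v = if b' && c then w else 0) ->
  (line_map w b' \o I_map b b' c = f \o line_map v b)%VF.
Proof.
move=> fv; apply/lfunP => u; rewrite !comp_lfunE.
case: b fv u => [/(_ isT) fv|_] u; last by rewrite (I_space_false u) !linear0.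
rewrite [in RHS]lfunE /= /scale_by linearZ /= fv.
case: b' {fv} => /=; last by rewrite scaler0 zero_lfunE.
by case: c; rewrite ?zero_lfunE ?linear0 ?scaler0 // id_lfunE lfunE.
Qed.

Section SimpleInclusion.
Variables (M : fmodule rat AA) (k : A_ob) (k_neq3 : k != a3) (v : M k).

(** A single vector at [k], turned into a family over all objects, since a
    natural transformation needs a target vector at every object. *)
Definition extend_by_zero (x : A_ob) : M x :=
  match k =P x with
  | ReflectT e => eq_rect k (fun y : AA => M y) v x e
  | _ => 0
  end.

Lemma extend_by_zeroE : extend_by_zero k = v.
Proof.
rewrite /extend_by_zero; case: eqP => // e.
by rewrite (eq_irrelevance e erefl).
Qed.

Definition simple_incl (x : AA) : 'Hom(I_ k_neq3 x, M x) :=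
  line_map (extend_by_zero x) (x == k).

Lemma simple_incl_natural :
  (forall x (p : A_mor x k),
     ~~ is_id x k (val p) -> fm_act M (p : hom (x : AA) k) v = 0) ->
  natural simple_incl.
Proof.
move=> killed x y p; apply: line_map_natural => /eqP e; subst y.
rewrite extend_by_zeroE.
have [pid|pnid] := boolP (is_id x k (val p)); last by rewrite andbF killed.
have /andP[/eqP e /eqP pE] := pid; subst x.
have -> : p = idm (k : AA) by apply: val_inj; rewrite pE.
by rewrite eqxx fm_id id_lfunE extend_by_zeroE.
Qed.

Lemma simple_incl_inj : v != 0 -> forall x, lker (simple_incl x) = 0%VS.
Proof.
move=> v0 x; apply: lker_line_map => /eqP e; subst x.
by rewrite extend_by_zeroE.
Qed.

End SimpleInclusion.

(** * The object a_3 *)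

Fact from_a3P x : Lf \in A_labels a3 x.
Proof. by case: x. Qed.

Fact to_a3P x : x != a4 -> Lf \in A_labels x a3.
Proof. by case: x. Qed.

Definition from_a3 (x : A_ob) : hom (a3 : AA) x := exist _ Lf (from_a3P x).

Definition to_a3 (x : A_ob) (x4 : x != a4) : hom (x : AA) a3 :=
  exist _ Lf (to_a3P x4).

Lemma from_a3K (x : A_ob) (q : hom (x : AA) a3) :
  comp q (from_a3 x) = idm (a3 : AA).
Proof. by apply: val_inj; case: x q => [] [[]]. Qed.

Lemma hom_a3_unique (x : A_ob) (q r : hom (x : AA) a3) : q = r.
Proof. by apply: val_inj; case: x q r => [] [[] //= e] [[] //= e']. Qed.

(** The composite is [f_xz], and so is the composite of [f_x3] and [f_3z]; the
    former exists because a_4 has no non-identity morphism out of it. *)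
Lemma comp_nonid_factors x y z (q : A_mor y z) (p : A_mor x y) :
  ~~ is_id x y (val p) -> ~~ is_id y z (val q) ->
  exists r : hom (x : AA) a3,
    comp (q : hom (y : AA) z) (p : hom (x : AA) y) = comp (from_a3 z) r.
Proof.
move=> pnid qnid; have x4 : x != a4.
  by apply: contraNneq pnid => e; subst x; case: p => -[]; case: y {q qnid}.
exists (to_a3 x4); apply: val_inj; move: pnid qnid x4 => /=.
by case: p => -[] ep; case: q => -[] eq /=; case: x ep; case: y eq; case: z.
Qed.

(** At [x] the free module has at most one basis vector, some [r : x -> a3],
    and it is sent to the action of [r] on [v]; this is nonzero because [r] has
    a right inverse, so that [r] acts injectively. *)
Lemma yoneda_a3_inj (M : fmodule rat AA) (v : M a3) :
  v != 0 -> forall x, lker (yoneda v x) = 0%VS.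
Proof.
move=> v0 x; apply/eqP; rewrite -subv0; apply/subvP => u.
rewrite memv_ker memv0 lfunE /= => /eqP uv0.
apply/eqP/ffunP => r; rewrite ffunE.
move: uv0; rewrite /yoneda_fun (big_pred1 r) => [|q]; last first.
  by apply/esym/eqP/hom_a3_unique.
move=> /(congr1 (fm_act M (from_a3 x))); rewrite linear0 linearZ /=.
rewrite -comp_lfunE -fm_comp from_a3K fm_id id_lfunE => /eqP.
by rewrite scaler_eq0 (negPf v0) orbF => /eqP.
Qed.

(** * Devissage *)

Lemma dim0_eq0 (F : fieldType) (V : vectType F) (v : V) :
  \dim {:V} = 0%N -> v = 0.
Proof.
by move/eqP; rewrite dimv_eq0 => /eqP V0; apply/eqP; rewrite -memv0 -V0 memvf.
Qed.

Lemma dim_neq0_vec (F : fieldType) (V : vectType F) :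
  \dim {:V} != 0%N -> exists v : V, v != 0.
Proof.
by rewrite dimv_eq0 => V0; exists (vpick {:V}); rewrite vpick0.
Qed.

(** If some non-identity [q] acts on some [u] by a nonzero vector, then that
    vector works: a further non-identity morphism would act on [u] through a
    composite of two, hence through [M a3]. *)
Lemma exists_socle_vector (M : fmodule rat AA) (y : A_ob) :
  \dim {: M a3} = 0%N -> \dim {: M y} != 0%N ->
  exists (k : A_ob) (v : M k), v != 0 /\ forall x (p : A_mor x k),
    ~~ is_id x k (val p) -> fm_act M (p : hom (x : AA) k) v = 0.
Proof.
move=> M3 /dim_neq0_vec[w w0].
have [[k [z [q [u [qnid qu]]]]]|none] :=
    pselect (exists k z (q : A_mor k z) (u : M z),
      ~~ is_id k z (val q) /\ fm_act M (q : hom (k : AA) z) u <> 0).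
  exists k, (fm_act M (q : hom (k : AA) z) u); split; first exact/eqP.
  move=> x p pnid; rewrite -comp_lfunE -fm_comp.
  have [r ->] := comp_nonid_factors pnid qnid.
  by rewrite fm_comp comp_lfunE (dim0_eq0 (fm_act M (from_a3 z) u)) // linear0.
exists y, w; split=> // x p pnid; apply: contrapT => pw.
by apply: none; exists x, y, p, w.
Qed.

Definition total_dim (M : fmodule rat AA) : nat :=
  (\dim {: M a1} + \dim {: M a2} + \dim {: M a3} + \dim {: M a4})%N.

Lemma vect_ses_dim (F : fieldType) (U V W : vectType F)
    (i : 'Hom(U, V)) (p : 'Hom(V, W)) :
  short_exact i p -> \dim {:V} = (\dim {:U} + \dim {:W})%N.
Proof.
by move=> ip; have [] := dim_additive (ex_intro _ i (ex_intro _ p ip)).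
Qed.

Lemma total_dim_ses L M N :
  module_ses L M N -> total_dim M = (total_dim L + total_dim N)%N.
Proof.
move=> [i [p [_ _ ex]]]; rewrite /total_dim.
rewrite (vect_ses_dim (ex a1)) (vect_ses_dim (ex a2)) (vect_ses_dim (ex a3)).
by rewrite (vect_ses_dim (ex a4)); lia.
Qed.

Lemma dim_I_space b : \dim {: I_space b} = b.
Proof. by case: b; rewrite /= dimvf ?dim_matrix. Qed.

Lemma dim_I k (k_neq3 : k != a3) (x : A_ob) :
  \dim {: I_ k_neq3 x} = (x == k).
Proof. exact: dim_I_space. Qed.

Lemma dim_Qmor c y : \dim {: Qmor c y} = size (A_labels y c).
Proof.
rewrite dimvf /=.
have -> : dim (Qmor_val c y) = #|{: A_mor y c}| by rewrite /dim /= muln1.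
by rewrite card_sig; apply/card_uniqP; case: y; case: c.
Qed.

Lemma devissage (P : fmodule rat AA -> Prop) :
  (forall M : fmodule rat AA, (forall x, \dim {: M x} = 0%N) -> P M) ->
  (forall L M N, module_ses L M N -> P L -> P N -> P M) ->
  P (I_ (k := a1) isT) -> P (I_ (k := a2) isT) -> P (Qmor a3) ->
  P (I_ (k := a4) isT) -> forall M, P M.
Proof.
move=> P0 Pses P1 P2 P3 P4 M.
have [n] := ubnP (total_dim M); elim: n M => // n IH M leMn.
have step (L : fmodule rat AA) (i : forall x, 'Hom(L x, M x)) : natural i ->
    (forall x, lker (i x) = 0%VS) -> P L -> (0 < total_dim L)%N -> P M.
  move=> i_nat i_inj PL L_gt0; have [N LMN] := module_ses_coker i_nat i_inj.
  by apply: (Pses _ _ _ LMN PL); apply: IH; have := total_dim_ses LMN; lia.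
have [M3|/dim_neq0_vec[v v0]] := eqVneq (\dim {: M a3}) 0%N; last first.
  apply: step (yoneda_natural v) (yoneda_a3_inj v0) P3 _.
  by rewrite /total_dim !dim_Qmor.
have [zero|/existsNP[y /eqP My]] := pselect (forall x, \dim {: M x} = 0%N).
  exact: P0.
have [k [v [v0 killed]]] := exists_socle_vector M3 My.
have k3 : k != a3.
  by apply: contraNneq v0 => e; subst k; rewrite (dim0_eq0 v) ?eqxx.
apply: step (simple_incl_natural k3 killed) (simple_incl_inj k3 v0) _ _.
  move: k3; clear -P1 P2 P4; case: k => // k3.
  + by rewrite (bool_irrelevance k3 isT).
  + by rewrite (bool_irrelevance k3 isT).
  + by rewrite (bool_irrelevance k3 isT).
by rewrite /total_dim !dim_I; case: k k3 {v v0 killed}.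
Qed.

(** The sequence [M -> M -> M] of zero maps is exact, so [M] = [M] + [M]. *)
Lemma mcls_zero (F : fieldType) (C : category) (M : fmodule F C) :
  (forall x, \dim {: M x} = 0%N) -> mcls M = ab_zero.
Proof.
move=> M0; apply: (@ab_addI _ (mcls M)); rewrite ab_addr0; apply/esym/gcls_ses.
exists (fun x => 0), (fun x => 0).
split=> [x y p|x y p|x]; try by rewrite comp_lfun0l comp_lfun0r.
have full0 : fullv = 0%VS :> {vspace M x}.
  by apply/eqP; rewrite -dimv_eq0 M0.
have sub0 (W : {vspace M x}) : W = 0%VS.
  by apply/eqP; rewrite -subv0 -full0 subvf.
by split; apply: etrans (sub0 _) (esym (sub0 _)).
Qed.

Lemma G0_hom_ext (G : abGroup) (f g : G0 rat AA -> G) :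
  is_hom f -> is_hom g ->
  f (mcls (I_ (k := a1) isT)) = g (mcls (I_ (k := a1) isT)) ->
  f (mcls (I_ (k := a2) isT)) = g (mcls (I_ (k := a2) isT)) ->
  f (mcls (Qmor a3)) = g (mcls (Qmor a3)) ->
  f (mcls (I_ (k := a4) isT)) = g (mcls (I_ (k := a4) isT)) -> f =1 g.
Proof.
move=> fD gD e1 e2 e3 e4; apply: groth_hom_unique => //.
apply: devissage => // [M M0|L M N LMN fgL fgN].
  by rewrite -/(mcls M) mcls_zero // !hom_zero.
by rewrite (gcls_ses LMN) fD gD fgL fgN.
Qed.

(** * Dimension vectors *)

Lemma rk_hom (F : fieldType) : is_hom (@rk F).
Proof. exact: groth_lift_hom. Qed.

Lemma rk_vcls (F : fieldType) (V : vectType F) : rk (vcls V) = (\dim {:V})%:Z.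
Proof. exact: groth_lift_cls. Qed.

Lemma Res_at_hom (F : fieldType) (C : category) (c : C) :
  is_hom (@Res_at F C c).
Proof. exact: groth_lift_hom. Qed.

Lemma Res_at_mcls (F : fieldType) (C : category) (c : C) (M : fmodule F C) :
  Res_at c (mcls M) = vcls (M c).
Proof. exact: groth_lift_cls. Qed.

Definition dim_vector (x : G0 rat AA) : pow4_ab ZZ := rk4 (Res x).

Lemma dim_vector_hom : is_hom dim_vector.
Proof.
by move=> x y; rewrite /dim_vector /Res !Res_at_hom /= !rk_hom.
Qed.

Lemma dim_vector_mcls (M : fmodule rat AA) :
  dim_vector (mcls M) = ((\dim {: M a1})%:Z, (\dim {: M a2})%:Z,
                         (\dim {: M a3})%:Z, (\dim {: M a4})%:Z).
Proof.
by rewrite /dim_vector /Res !Res_at_mcls /= !rk_vcls.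
Qed.

Lemma dim_vector_omega (n1 n2 n3 n4 : int) :
  dim_vector (omega (n1, n2, n3, n4)) = (n1 + n3, n2 + n3, n3, n4).
Proof.
rewrite /omega !dim_vector_hom !(hom_mulz _ dim_vector_hom) !dim_vector_mcls.
rewrite !dim_Qmor !dim_I !pow4_mulz !pow4_add !int_mulz /=.
by congr (_, _, _, _); ring.
Qed.

(** The inverse of [(n1, n2, n3, n4) |-> (n1 + n3, n2 + n3, n3, n4)]. *)
Definition dim_coords (m : pow4_ab ZZ) : pow4_ab ZZ :=
  let: (m1, m2, m3, m4) := m in (m1 - m3, m2 - m3, m3, m4).

Lemma dim_coords_hom : is_hom dim_coords.
Proof.
move=> [[[m1 m2] m3] m4] [[[n1 n2] n3] n4].
rewrite pow4_add /dim_coords [RHS]pow4_add /=.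
by congr (_, _, _, _); ring.
Qed.

Lemma omega_hom : is_hom omega.
Proof.
move=> [[[m1 m2] m3] m4] [[[n1 n2] n3] n4]; rewrite pow4_add /omega !ab_mulzD.
exact: ab_add4.
Qed.

(** Both sides are homomorphisms in [x], so the four classes suffice; their
    coordinates are the standard basis vectors. *)
Lemma omega_dim_coords x : omega (dim_coords (dim_vector x)) = x.
Proof.
move: x; apply: G0_hom_ext => //.
  apply: hom_comp omega_hom _.
  exact: hom_comp dim_coords_hom dim_vector_hom.
all: rewrite dim_vector_mcls !(dim_I, dim_Qmor).
- rewrite -[dim_coords _]/(1, 0, 0, 0) /omega.
  by rewrite ab_mul1z !ab_mul0z !ab_addr0.
- rewrite -[dim_coords _]/(0, 1, 0, 0) /omega.
  by rewrite ab_mul1z !ab_mul0z ab_add0 !ab_addr0.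
- rewrite -[dim_coords _]/(0, 0, 1, 0) /omega.
  by rewrite ab_mul1z !ab_mul0z !ab_add0 ab_addr0.
- rewrite -[dim_coords _]/(0, 0, 0, 1) /omega.
  by rewrite ab_mul1z !ab_mul0z !ab_add0.
Qed.

Theorem theorem10p17 :
  is_iso omega /\ is_iso (fun x : G0 rat AA => rk4 (Res x)).
Proof.
split; split.
- exact: omega_hom.
- exists (fun x => dim_coords (dim_vector x)); last exact: omega_dim_coords.
  move=> [[[n1 n2] n3] n4]; rewrite dim_vector_omega /=.
  by rewrite !addrK.
- exact: dim_vector_hom.
- exists (fun m => omega (dim_coords m)); first exact: omega_dim_coords.
  by move=> [[[m1 m2] m3] m4]; rewrite -/(dim_vector _) dim_vector_omega !subrK.
Qed.
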